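(* $(S_n/\!\sim,* )$ is a commutative monoid.
   Context: $S_n$ is the symmetric group on $\{1,\dots,n\}$ with group operation ''$\cdot$'' and identity $e$. The orbits of $\sigma\in S_n$ are its orbits on $\{1,\dots,n\}$. For $\sigma,\eta\in S_n$, $\sigma\sim\eta$ if and only if $\sigma$ and $\eta$ have the same orbits; $[\sigma]$ is the equivalence class of $\sigma$ and $S_n/\!\sim$ is the set of classes. Operation $*$: for transpositions $\sigma,\eta$, $\sigma*\eta=\sigma$ if $\sigma=\eta$, and $\sigma*\eta=\sigma\cdot\eta$ otherwise. It is extended to all permutations through decompositions into transpositions: for a transposition $\tau=(i,j)$ and $\sigma\in S_n$, $\sigma*\tau=\tau*\sigma=\sigma$ if $i,j$ lie in the same orbit of $\sigma$, while otherwise $\sigma*\tau=\sigma\cdot\tau$ and $\tau*\sigma=\tau\cdot\sigma$. For general $\sigma,\eta$, choose a decomposition $\eta=\tau_1\cdots\tau_r$ into a minimal number of transpositions and set $\sigma*\eta=(\cdots((\sigma*\tau_1)*\tau_2)*\cdots)*\tau_r$, or else choose such a decomposition $\sigma=\rho_1\cdots\rho_s$ and set $\sigma*\eta=\rho_1*(\cdots*(\rho_{s-1}*(\rho_s*\eta))\cdots)$. The resulting permutation may depend on the choices made. On classes, $[\sigma]*[\eta]:=[\sigma*\eta]$; part of the assertion is that this is well defined (independent of choices and representatives). *)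

(* Defs.v *)
From mathcomp Require Import all_boot all_fingroup.
Set Implicit Arguments.
Unset Strict Implicit.
Unset Printing Implicit Defensive.

Local Open Scope group_scope.
Local Open Scope quotient_scope.

Section OrbitMonoid.
Variable n : nat.

Definition same_orbits : rel 'S_n := fun s t => porbits s == porbits t.

Lemma same_orbits_refl : reflexive same_orbits.
Proof. by move=> s; exact: eqxx. Qed.

Lemma same_orbits_sym : symmetric same_orbits.
Proof. by move=> s t; exact: eq_sym. Qed.

Lemma same_orbits_trans : transitive same_orbits.
Proof. by move=> t s u /eqP st /eqP tu; apply/eqP; rewrite st. Qed.

Canonical same_orbits_equiv :=
  EquivRel same_orbits same_orbits_refl same_orbits_sym same_orbits_trans.

Definition orbit_class := {eq_quot same_orbits}.

Definition class_of (s : 'S_n) : orbit_class := \pi_orbit_class s.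

(* A transposition (i, j) is given by a pair p = (i, j) with dpair p, i.e.
   i != j, as in prod_tpermP; it denotes the permutation tperm i j.  The group
   law of 'S_n composes from left to right; with the other convention the
   possible values of s * t below become those of t * s. *)

Definition transp_starr (s : 'S_n) (p : 'I_n * 'I_n) : 'S_n :=
  if p.2 \in porbit s p.1 then s else s * tperm p.1 p.2.

Definition transp_starl (p : 'I_n * 'I_n) (s : 'S_n) : 'S_n :=
  if p.2 \in porbit s p.1 then s else tperm p.1 p.2 * s.

Definition decomposes (s : 'S_n) (ts : seq ('I_n * 'I_n)) : Prop :=
  all dpair ts /\ s = \prod_(p <- ts) tperm p.1 p.2.

Definition min_decomposes (s : 'S_n) (ts : seq ('I_n * 'I_n)) : Prop :=
  decomposes s ts /\ (forall us, decomposes s us -> size ts <= size us).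

(* The operation on permutations depends on choices, so it is given by its
   graph: r is one of the permutations obtainable as s * t. *)
Definition star_value (s t r : 'S_n) : Prop :=
  (exists2 ts, min_decomposes t ts & r = foldl transp_starr s ts) \/
  (exists2 ss, min_decomposes s ss & r = foldr transp_starl t ss).

End OrbitMonoid.

(* Main.v *)
Require Import Defs.
From HB Require Import structures.
From mathcomp Require Import all_boot all_fingroup zify.

(** Up to the relation ~, a permutation s is the partition of the points into
    its orbits, and * is the join of partitions.  A partition is determined by
    the family of the sets that are unions of its blocks, here the sets stable
    under s ([stable_sets], [stable_sets_porbits]), and the join of two
    partitions corresponds to the intersection of their two families.  In terms
    of families the monoid laws are therefore those of set intersection, with
    the family of all sets, which is that of the identity, as the unit.

    It remains to see that every value of s * t, whatever the choices, has as
    its stable sets those common to s and t ([star_value_stable_sets]).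
    - Multiplying s by a transposition (x y) whose points lie in distinct
      orbits of s merges these two orbits: the orbit count of
      [porbits_mul_tperm] drops by one, and multiplying by (x y) again must
      raise it by one, which happens only if x and y share an orbit of the
      product.  Hence a single step of * intersects the family of s with that
      of (x y) ([stable_sets_tpermM], [stable_sets_Mtperm]), and a whole chain
      of steps intersects it with the families of all the transpositions.
    - A product of r transpositions has at least N - r orbits on N points, and
      some decomposition attains equality.  In a minimal decomposition of t,
      each factor thus merges two orbits of the product of those after it, so
      the stable sets of t are exactly those common to the factors
      ([min_decomposes_stable_sets]). *)

Set Implicit Arguments.
Unset Strict Implicit.
Unset Printing Implicit Defensive.

Local Open Scope group_scope.
Local Open Scope quotient_scope.

(** * Stable sets of a permutation *)

Section StableSets.
Variable T : finType.
Implicit Types (s t : {perm T}) (x y : T) (A : {set T}).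

Definition stable_sets s : {set {set T}} :=
  [set A : {set T} | [forall x, (s x \in A) == (x \in A)]].

Lemma stable_setsP s A :
  reflect (forall x, (s x \in A) = (x \in A)) (A \in stable_sets s).
Proof. by rewrite inE; apply: (iffP forallP) => sA x; apply/eqP. Qed.

Lemma stable_set_porbit s A x y :
  A \in stable_sets s -> y \in porbit s x -> (y \in A) = (x \in A).
Proof.
move=> /stable_setsP sA /porbitP[i ->].
by elim: i => [|i IHi]; rewrite ?expg0 ?perm1 // expgSr permM sA.
Qed.

Lemma porbit_stable s x : porbit s x \in stable_sets s.
Proof.
apply/stable_setsP => y; by rewrite -!eq_porbit_mem -(porbit_perm s 1 y) expg1.
Qed.

Lemma eq_porbits_porbit s t x :
  porbits s = porbits t -> porbit s x = porbit t x.
Proof.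
move=> st; have /imsetP[y _ def_x]: porbit s x \in porbits t.
  by rewrite -st imset_f.
by have := porbit_id s x; rewrite def_x -eq_porbit_mem => /eqP <-.
Qed.

Lemma stable_sets_sub_porbit s t :
  (forall x, porbit s x = porbit t x) -> stable_sets t \subset stable_sets s.
Proof.
move=> st; apply/subsetP => A tA; apply/stable_setsP => x.
by apply: stable_set_porbit tA _; rewrite -st -[s]expg1 mem_porbit.
Qed.

(** The orbits are themselves stable, and the orbit of a point is the least
    stable set that contains it; so either family recovers the other. *)
Lemma stable_sets_porbits s t :
  (porbits s == porbits t) = (stable_sets s == stable_sets t).
Proof.
apply/eqP/eqP => st.
  by apply/eqP; rewrite eqEsubset !stable_sets_sub_porbit // => x;
     apply: eq_porbits_porbit.
have sub u v x : stable_sets u = stable_sets v -> porbit u x \subset porbit v x.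
  move=> uv; apply/subsetP => y ux.
  have vx: porbit v x \in stable_sets u by rewrite uv porbit_stable.
  by rewrite (stable_set_porbit vx ux) porbit_id.
by apply: eq_imset => x; apply/eqP; rewrite eqEsubset !sub.
Qed.

Lemma stable_sets1 : stable_sets 1 = setT.
Proof.
by apply/setP => A; rewrite in_setT; apply/stable_setsP => x; rewrite perm1.
Qed.

Lemma stable_setsV s : stable_sets s^-1 = stable_sets s.
Proof. by apply/eqP; rewrite -stable_sets_porbits porbitsV. Qed.

Lemma stable_sets_mul s t :
  stable_sets s :&: stable_sets t \subset stable_sets (s * t).
Proof.
apply/subsetP => A /setIP[/stable_setsP sA /stable_setsP tA].
by apply/stable_setsP => x; rewrite permM tA sA.
Qed.

Lemma stable_sets_tperm x y A :
  (A \in stable_sets (tperm x y)) = ((x \in A) == (y \in A)).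
Proof.
apply/stable_setsP/eqP => [/(_ y)|Axy z]; first by rewrite tpermR.
by case: tpermP => [->|->|].
Qed.

Lemma stable_sets_sub_tperm s x y :
  y \in porbit s x -> stable_sets s \subset stable_sets (tperm x y).
Proof.
move=> sxy; apply/subsetP => A sA.
by rewrite stable_sets_tperm (stable_set_porbit sA sxy).
Qed.

(** Both multiplications by [tperm x y], of [s] and of the product, are counted
    with [porbits_mul_tperm]; since they cancel out, exactly one of them
    merges orbits. *)
Lemma porbit_tpermM s x y :
  y \notin porbit s x -> y \in porbit (tperm x y * s) x.
Proof.
move=> sxy; have xy: x != y by apply: contraNneq sxy => <-; apply: porbit_id.
have := porbits_mul_tperm s x y; have := porbits_mul_tperm (tperm x y * s) x y.
rewrite /= mulgA tperm2 mul1g xy !(porbit_sym _ x y) sxy.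
by case: (y \in _) => //=; lia.
Qed.

(** Stable sets common to two permutations are stable under their product.
    This gives one inclusion; it gives the other as well, because [s] is the
    product of [tperm x y] and [tperm x y * s], and every set stable under the
    latter is stable under the former, as [x] and [y] share an orbit there. *)
Lemma stable_sets_tpermM s x y :
  y \notin porbit s x ->
  stable_sets (tperm x y * s) = stable_sets (tperm x y) :&: stable_sets s.
Proof.
move=> /porbit_tpermM txy; apply/eqP; rewrite eqEsubset stable_sets_mul andbT.
have subt := stable_sets_sub_tperm txy.
rewrite subsetI subt /= -{2}[s]mul1g -(tperm2 x y) -mulgA.
by apply: subset_trans (stable_sets_mul _ _); rewrite subsetI subt /=.
Qed.

(** Inversion exchanges the two sides and keeps the orbits. *)
Lemma stable_sets_Mtperm s x y :
  y \notin porbit s x ->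
  stable_sets (s * tperm x y) = stable_sets s :&: stable_sets (tperm x y).
Proof.
move=> sxy; rewrite -stable_setsV invMg tpermV stable_sets_tpermM ?porbitV //.
by rewrite stable_setsV setIC.
Qed.

(** * Decompositions into few transpositions *)

Lemma card_porbits1 : #|porbits (1 : {perm T})| = #|T|.
Proof.
rewrite card_imset // => x y /eqP; rewrite eq_porbit_mem => /porbitP[i].
by rewrite expg1n perm1.
Qed.

Lemma leq_card_porbits_tpermM s x y :
  #|porbits s| <= #|porbits (tperm x y * s)|.+1.
Proof.
have := porbits_mul_tperm s x y => /=.
have [-> | _] := eqVneq x y; first by rewrite tperm1 mul1g.
by case: (x \in porbit s y) => /=; lia.
Qed.

Lemma leq_card_porbits_tpermM_same_orbit s x y :
  y \in porbit s x -> #|porbits s| <= #|porbits (tperm x y * s)|.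
Proof.
move=> sxy; have := porbits_mul_tperm s x y.
by rewrite /= porbit_sym sxy addn0 => ->; apply: leq_addr.
Qed.

(** The identity has [#|T|] orbits, and each factor lowers the number of orbits
    by at most one. *)
Lemma leq_size_prod_tperm (ts : seq (T * T)) :
  #|T| <= size ts + #|porbits (\prod_(p <- ts) tperm p.1 p.2)|.
Proof.
elim: ts => [|p ts IHts]; first by rewrite big_nil card_porbits1.
apply: leq_trans IHts _; rewrite big_cons /= addSnnS leq_add2l.
exact: leq_card_porbits_tpermM.
Qed.

(** A point moved by [s] shares its orbit with its image, so the transposition
    of the two splits that orbit: repeating this reaches the identity after
    [#|T| - #|porbits s|] steps. *)
Lemma short_prod_tperm s :
  exists ts : seq (T * T), [/\ all dpair ts, s = \prod_(p <- ts) tperm p.1 p.2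
                             & size ts + #|porbits s| <= #|T|].
Proof.
have leT u : #|porbits u| <= #|T| := leq_imset_card (porbit u) T.
have [m] := ubnP (#|T| - #|porbits s|); elim: m s => // m IHm s ltm.
have [x sx | s1] := pickP (fun x => s x != x); last first.
  exists [::]; split; rewrite ?big_nil ?leT //.
  by apply/permP => x; rewrite perm1; apply/eqP/negbFE/s1.
have cnt: #|porbits (tperm x (s x) * s)| = #|porbits s|.+1.
  have := porbits_mul_tperm s x (s x).
  have sxx: s x \in porbit s x by have := mem_porbit s 1 x; rewrite expg1.
  by rewrite /= porbit_sym sxx eq_sym sx addn0 addn1.
have [|ts [dts def_s le_ts]] := IHm (tperm x (s x) * s).
  by have := leT (tperm x (s x) * s); rewrite cnt; lia.
exists ((x, s x) :: ts); split; rewrite ?big_cons /=.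
- by rewrite /dpair /= eq_sym sx.
- by rewrite -def_s mulgA tperm2 mul1g.
- by rewrite addSnnS -cnt.
Qed.

Definition common_stable_sets (ts : seq (T * T)) : {set {set T}} :=
  \bigcap_(p <- ts) stable_sets (tperm p.1 p.2).

(** With so few factors for so many orbits, no factor can fail to merge two
    orbits of the product of the factors after it. *)
Lemma stable_sets_short_prod (ts : seq (T * T)) :
    size ts + #|porbits (\prod_(p <- ts) tperm p.1 p.2)| <= #|T| ->
  stable_sets (\prod_(p <- ts) tperm p.1 p.2) = common_stable_sets ts.
Proof.
rewrite /common_stable_sets.
elim: ts => [|p ts IHts]; first by rewrite !big_nil stable_sets1.
rewrite !big_cons => le_pts; set u : {perm T} := \prod_(_ <- _) _ in le_pts *.
have up: p.2 \notin porbit u p.1.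
  apply: contraTN le_pts => /leq_card_porbits_tpermM_same_orbit le_u.
  rewrite -ltnNge /= ltnS; apply: leq_trans (leq_size_prod_tperm ts) _.
  by rewrite leq_add2l.
rewrite stable_sets_tpermM // IHts //; apply: leq_trans le_pts.
by rewrite addSnnS leq_add2l leq_card_porbits_tpermM.
Qed.

End StableSets.

(** * The operation * on permutations and on classes *)

Section StarValues.
Variable n : nat.
Implicit Types (s t r : 'S_n) (p : 'I_n * 'I_n) (ts : seq ('I_n * 'I_n)).

Lemma min_decomposes_exists t : exists ts, min_decomposes t ts.
Proof.
have [ts [dts def_t le_ts]] := short_prod_tperm t.
exists ts; split=> // us [_ def_us].
rewrite -(leq_add2r #|porbits t|); apply: leq_trans le_ts _.
by rewrite [in porbits t]def_us; apply: leq_size_prod_tperm.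
Qed.

(** A decomposition as short as that of [short_prod_tperm] exists, so a minimal
    one meets the length bound of [stable_sets_short_prod]. *)
Lemma min_decomposes_stable_sets t ts :
  min_decomposes t ts -> stable_sets t = common_stable_sets ts.
Proof.
case=> [[_ def_t]] min_ts.
have [us [dus def_us le_us]] := short_prod_tperm t.
rewrite def_t stable_sets_short_prod // -def_t; apply: leq_trans le_us.
by rewrite leq_add2r; apply: min_ts.
Qed.

Lemma transp_starr_stable_sets s p :
  stable_sets (transp_starr s p)
    = stable_sets s :&: stable_sets (tperm p.1 p.2).
Proof.
rewrite /transp_starr; case: ifPn => [sp | /stable_sets_Mtperm//].
by apply/esym/setIidPl/stable_sets_sub_tperm.
Qed.

Lemma transp_starl_stable_sets p s :
  stable_sets (transp_starl p s)
    = stable_sets (tperm p.1 p.2) :&: stable_sets s.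
Proof.
rewrite /transp_starl; case: ifPn => [sp | /stable_sets_tpermM//].
by apply/esym/setIidPr/stable_sets_sub_tperm.
Qed.

Lemma foldl_transp_starr_stable_sets s ts :
  stable_sets (foldl (@transp_starr n) s ts)
    = stable_sets s :&: common_stable_sets ts.
Proof.
rewrite /common_stable_sets.
elim: ts s => [|p ts IHts] s /=; first by rewrite big_nil setIT.
by rewrite IHts transp_starr_stable_sets big_cons setIA.
Qed.

Lemma foldr_transp_starl_stable_sets t ts :
  stable_sets (foldr (@transp_starl n) t ts)
    = common_stable_sets ts :&: stable_sets t.
Proof.
rewrite /common_stable_sets.
elim: ts => [|p ts IHts] /=; first by rewrite big_nil setTI.
by rewrite transp_starl_stable_sets IHts big_cons setIA.
Qed.

(** The right-hand side does not mention the decomposition, and it depends on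
    [s] and [t] only through their classes: this is why * is well defined on
    classes, and why it does not matter which argument is decomposed. *)
Lemma star_value_stable_sets s t r :
  star_value s t r -> stable_sets r = stable_sets s :&: stable_sets t.
Proof.
case=> [[ts /min_decomposes_stable_sets-> ->]|
        [ss /min_decomposes_stable_sets-> ->]].
  exact: foldl_transp_starr_stable_sets.
exact: foldr_transp_starl_stable_sets.
Qed.

Lemma star_value_exists s t : exists r, star_value s t r.
Proof.
have [ts min_ts] := min_decomposes_exists t.
by exists (foldl (@transp_starr n) s ts); left; exists ts.
Qed.

Lemma stable_sets_meet_exists s t :
  exists r, stable_sets r == stable_sets s :&: stable_sets t.
Proof.
have [r str] := star_value_exists s t; exists r.
by rewrite (star_value_stable_sets str).
Qed.

Definition class_stable_sets (a : orbit_class n) : {set {set 'I_n}} :=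
  stable_sets (generic_quotient.repr a).

Lemma class_stable_sets_class_of s :
  class_stable_sets (class_of s) = stable_sets s.
Proof.
apply/eqP; rewrite -stable_sets_porbits.
by have /eqmodP := reprK (class_of s).
Qed.

Lemma class_stable_sets_inj : injective class_stable_sets.
Proof.
move=> a b /eqP; rewrite -stable_sets_porbits => ab.
by rewrite -[a]reprK -[b]reprK; apply/eqmodP.
Qed.

(** Any permutation with the right stable sets will do as a representative,
    since they determine its class. *)
Definition class_star (a b : orbit_class n) : orbit_class n :=
  class_of (xchoose (stable_sets_meet_exists (generic_quotient.repr a)
                                             (generic_quotient.repr b))).

Lemma class_stable_sets_star a b :
  class_stable_sets (class_star a b)
    = class_stable_sets a :&: class_stable_sets b.
Proof.
rewrite class_stable_sets_class_of.
exact: eqP (xchooseP (stable_sets_meet_exists _ _)).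
Qed.

Lemma class_starA : associative class_star.
Proof.
by move=> a b c; apply: class_stable_sets_inj;
   rewrite !class_stable_sets_star setIA.
Qed.

Lemma class_starC : commutative class_star.
Proof.
by move=> a b; apply: class_stable_sets_inj;
   rewrite !class_stable_sets_star setIC.
Qed.

Lemma class_star1 : left_id (class_of 1) class_star.
Proof.
move=> a; apply: class_stable_sets_inj.
by rewrite class_stable_sets_star class_stable_sets_class_of stable_sets1 setTI.
Qed.

HB.instance Definition _ :=
  Monoid.isComLaw.Build (orbit_class n) (class_of 1) class_star
    class_starA class_starC class_star1.

End StarValues.

Theorem theorem3 (n : nat) :
  (forall s t : 'S_n, exists r : 'S_n, star_value s t r) /\
  (exists star : Monoid.com_law (class_of (1%g : 'S_n)),
     forall s t r : 'S_n,
       star_value s t r -> star (class_of s) (class_of t) = class_of r).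
Proof.
split; first exact: star_value_exists.
exists (@class_star n) => s t r /star_value_stable_sets str.
apply: class_stable_sets_inj.
by rewrite class_stable_sets_star !class_stable_sets_class_of str.
Qed.
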